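(* Let $X\in\mathbb R^{d\times n}$, $1\le K\le d$, $F(U)=\|X^\top U\|_1$, and let $\{U^k\}\subset\mathrm{St}(d,K)$ be generated by the conditional subgradient scheme CondGradU: for $k=0,1,2,\ldots$, $$U^{k+1}=\operatorname{PD}(XS^k),\qquad S^k\in\partial\|V\|_1\big|_{V=X^\top U^k}.$$ Then $F(U^k)$ is monotonically increasing (i.e. $F(U^{k+1})\ge F(U^k)$ for all $k$), and every limit point of $\{U^k\}$ is a FOC point, i.e. satisfies the first-order optimality criteria.
   Context: $\mathrm{St}(m,n)=\{U\in\mathbb R^{m\times n}: U^\top U=I\}$, $m\ge n$. $\|\cdot\|_1$ is the entrywise $L_1$-norm and $\langle\cdot,\cdot\rangle$ the Frobenius inner product. Polar decomposition: for $C\in\mathbb R^{m\times n}$, $m\ge n$, a polar decomposition is $C=UH$ with $U\in\mathrm{St}(m,n)$ and $H$ symmetric positive semidefinite; $U$ is called a $U$-factor of $C$. $U=\operatorname{PD}(C)$ means that $U$ is a $U$-factor of $C$ (equivalently, $U$ maximizes $\langle C,\cdot\rangle$ over $\mathrm{St}(m,n)$). $\partial\|V\|_1\big|_{V=X^\top U}$ is the subdifferential of $\|\cdot\|_1$ at $X^\top U$: the set of $S\in\mathbb R^{n\times K}$ with $S_{ij}=\operatorname{sgn}((X^\top U)_{ij})$ if $(X^\top U)_{ij}\neq0$ and $S_{ij}\in[-1,1]$ otherwise. $U\in\mathrm{St}(d,K)$ is a FOC point if there is $W\in X\,\partial\|V\|_1\big|_{V=X^\top U}$ with $\langle W,U-Z\rangle\ge0$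 for all $Z\in\mathrm{St}(d,K)$. *)

(* Defs.v *)
From mathcomp Require Import all_boot all_order all_algebra.
From mathcomp Require Import all_classical all_reals all_analysis.

Set Implicit Arguments.
Unset Strict Implicit.
Unset Printing Implicit Defensive.

Import Order.TTheory GRing.Theory Num.Theory.
Import numFieldNormedType.Exports.

Local Open Scope classical_set_scope.
Local Open Scope ring_scope.

Section Definitions.
Variable R : realType.

Definition stiefel (m n : nat) : set 'M[R]_(m, n) :=
  [set U | U^T *m U = 1%:M].

Definition frobenius (m n : nat) (A B : 'M[R]_(m, n)) : R :=
  \sum_(i < m) \sum_(j < n) A i j * B i j.

(* Not the library norm `|A|, which on matrices is the sup norm. *)
Definition l1norm (m n : nat) (A : 'M[R]_(m, n)) : R :=
  \sum_(i < m) \sum_(j < n) `|A i j|.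

Definition symmetric_psd (n : nat) (H : 'M[R]_n) : Prop :=
  H^T = H /\ forall x : 'cV[R]_n, 0 <= (x^T *m H *m x) 0 0.

(* A relation rather than a function: the U-factor is not unique when C is
   rank-deficient, and any choice is allowed. *)
Definition is_PD (m n : nat) (C U : 'M[R]_(m, n)) : Prop :=
  stiefel U /\ exists2 H : 'M[R]_n, symmetric_psd H & C = U *m H.

Definition l1_subdiff (m n : nat) (V : 'M[R]_(m, n)) : set 'M[R]_(m, n) :=
  [set S | forall i j, if V i j != 0 then S i j = Num.sg (V i j)
                       else -1 <= S i j <= 1].

Definition objective (d n K : nat) (X : 'M[R]_(d, n)) (U : 'M[R]_(d, K)) : R :=
  l1norm (X^T *m U).

Definition condGradU (d n K : nat) (X : 'M[R]_(d, n))
    (U : nat -> 'M[R]_(d, K)) (S : nat -> 'M[R]_(n, K)) : Prop :=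
  forall k : nat, l1_subdiff (X^T *m U k) (S k) /\ is_PD (X *m S k) (U k.+1).

Definition foc_point (d n K : nat) (X : 'M[R]_(d, n)) (U : 'M[R]_(d, K)) : Prop :=
  stiefel U /\
  exists2 W : 'M[R]_(d, K), (mulmx X @` l1_subdiff (X^T *m U)) W &
    forall Z : 'M[R]_(d, K), stiefel Z -> 0 <= frobenius W (U - Z).

End Definitions.

(* Main.v *)
Require Import Defs.
From mathcomp Require Import all_boot all_order all_algebra.
From mathcomp Require Import all_classical all_reals all_analysis.
From mathcomp Require Import lra.
Import Order.TTheory GRing.Theory Num.Theory.
Import numFieldNormedType.Exports.

Local Open Scope classical_set_scope.
Local Open Scope ring_scope.

(** If [C = U H] is a polar decomposition and [Z] lies on the Stiefel manifold,
    then [2 <C, U - Z> = tr ((U - Z) H (U - Z)^T) >= 0].  Hence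
    [<X S^k, Z> <= <S^k, X^T U^{k+1}> <= F(U^{k+1})] for every such [Z]; taking
    [Z = U^k] gives monotonicity.  For a limit point [L], pass to an
    ultrafilter along which [U^k] tends to [L] and the bounded [S^k] tend to
    some [S], which is a subgradient at [X^T L].  Since
    [F(U^k) <= F(L) = <X S, L>] by monotonicity, the limit of the displayed
    inequality is [<X S, Z> <= <X S, L>]. *)

Lemma frobenius_trace {R : realType} {m n : nat} (A B : 'M[R]_(m, n)) :
  frobenius A B = \tr (A^T *m B).
Proof.
rewrite /frobenius /mxtrace exchange_big /=; apply: eq_bigr => j _.
by rewrite mxE; apply: eq_bigr => i _; rewrite mxE.
Qed.

Lemma frobenius_mulmxl {R : realType} {d n K : nat} (X : 'M[R]_(d, n))
    (S : 'M[R]_(n, K)) (U : 'M[R]_(d, K)) :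
  frobenius (X *m S) U = frobenius S (X^T *m U).
Proof. by rewrite !frobenius_trace trmx_mul mulmxA. Qed.

Lemma frobeniusBr {R : realType} {m n : nat} (A B C : 'M[R]_(m, n)) :
  frobenius A (B - C) = frobenius A B - frobenius A C.
Proof. by rewrite !frobenius_trace mulmxBr raddfB. Qed.

(** Each diagonal entry of [M H M^T] is the quadratic form of [H] at a transposed row of [M]. *)
Lemma mxtrace_congr_ge0 {R : realType} {m n : nat} (H : 'M[R]_n)
    (M : 'M[R]_(m, n)) : symmetric_psd H -> 0 <= \tr (M *m H *m M^T).
Proof.
move=> [_ psdH]; rewrite /mxtrace; apply: sumr_ge0 => i _.
have := psdH (row i M)^T; rewrite trmxK -row_mul.
rewrite mxE [X in _ -> _ <= X]mxE; congr (is_true (_ <= _)).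
by apply: eq_bigr => j _; rewrite !mxE.
Qed.

Lemma is_PD_max {R : realType} {m n : nat} {C U : 'M[R]_(m, n)} (Z : 'M[R]_(m, n)) :
  is_PD C U -> stiefel Z -> frobenius C Z <= frobenius C U.
Proof.
rewrite /stiefel /= => -[UU [H psdH ->]] ZZ; have HT := psdH.1.
have := mxtrace_congr_ge0 _ (U - Z) psdH.
rewrite mxtrace_mulC !mulmxA [(U - Z)^T]linearB /= mulmxBr !mulmxBl UU ZZ.
rewrite !mul1mx !frobenius_trace trmx_mul HT -!mulmxA UU mulmx1.
rewrite !raddfB /=.
(* The two cross terms have equal trace, one by transposition and symmetry of [H], the other by
   cyclicity. What remains is [2 tr H - 2 tr (H U^T Z) >= 0]. *)
have -> : \tr (Z^T *m (U *m H)) = \tr (H *m (U^T *m Z)).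
  by rewrite -mxtrace_tr !trmx_mul trmxK HT mulmxA.
have -> : \tr (U^T *m (Z *m H)) = \tr (H *m (U^T *m Z)).
  by rewrite mulmxA mxtrace_mulC.
lra.
Qed.

(** Trades the case distinction on signs, which is not continuous in [V], for closed conditions that
    pass to limits. *)
Lemma l1_subdiffP {R : realType} {m n : nat} (V S : 'M[R]_(m, n)) :
  l1_subdiff V S <->
  forall i j, -1 <= S i j <= 1 /\ S i j * V i j = `|V i j|.
Proof.
split=> h i j; move: (h i j).
  have [-> |V0] /= := eqVneq (V i j) 0; first by rewrite mulr0 normr0.
  move=> ->; split; last by rewrite -normrEsg.
  by rewrite -ler_norml normr_sg lern1 leq_b1.
move=> [S1 SV]; case: eqVneq => //= V0.
by apply: (mulIf V0); rewrite -normrEsg.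
Qed.

Lemma frobenius_subdiff {R : realType} {m n : nat} {V S : 'M[R]_(m, n)} :
  l1_subdiff V S -> frobenius S V = l1norm V.
Proof.
by move=> /l1_subdiffP h; apply: eq_bigr => i _; apply: eq_bigr => j _;
  have [] := h i j.
Qed.

Lemma frobenius_le_l1norm {R : realType} {m n : nat} {S : 'M[R]_(m, n)}
    (V : 'M[R]_(m, n)) :
  (forall i j, -1 <= S i j <= 1) -> frobenius S V <= l1norm V.
Proof.
move=> S1; apply: ler_sum => i _; apply: ler_sum => j _.
by rewrite (le_trans (ler_norm _))// normrM ler_piMl// ler_norml.
Qed.

(** Plays the role of extracting a convergent subsequence. The sets [A] meet [f^-1(C)], for [A] in
    [F] and [C] a neighbourhood of [l], are nonempty because [l] is a cluster point; they generate a
    proper filter, which extends to an ultrafilter. *)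
Lemma cluster_image_ultra {T : Type} {V : topologicalType} {F : set_system T}
    {f : T -> V} {l : V} : Filter F -> cluster (f @ F) l ->
  exists G, [/\ UltraFilter G, F `<=` G & f @ G --> l].
Proof.
move=> FF cl.
pose D := [set AB : set T * set V | F AB.1 /\ nbhs l AB.2].
pose B (AB : set T * set V) := AB.1 `&` f @^-1` AB.2.
have DF : Filter (filter_from D B).
  apply: filter_from_filter; first by exists (setT, setT); split; exact: filterT.
  move=> [A1 B1] [A2 B2] [/= FA1 nB1] [/= FA2 nB2].
  exists (A1 `&` A2, B1 `&` B2); first by split; exact: filterI.
  by move=> x [[/= ? ?] [? ?]].
have DP : ProperFilter (filter_from D B).
  apply: filter_from_proper => -[A C] [/= FA nC].
  have [|_ [[x Ax <-] Cfx]] := cl (f @` A) C _ nC; last by exists x.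
  by move: FA; apply: (@filterS _ F) => x Ax; exists x.
have [G [UG DG]] := ultraFilterLemma DP; exists G; split=> // [A FA|C nC].
  by apply: DG; exists (A, setT); [split => //; exact: filterT|move=> x []].
by apply: DG; exists (setT, C); [split => //; exact: filterT|move=> x []].
Qed.

(** Working entrywise reduces limits of matrix products and norms to limits of finite sums of
    reals. *)
Definition mx_entry_cvg {R : realType} {T : Type} (G : set_system T) {m n : nat}
    (A : T -> 'M[R]_(m, n)) (L : 'M[R]_(m, n)) : Prop :=
  forall i j, (fun t => A t i j) @ G --> L i j.

Lemma cvg_mx_entry {R : realType} {T : Type} {G : set_system T} {m n : nat}
    (A : T -> 'M[R]_(m, n)) (L : 'M[R]_(m, n)) :
  Filter G -> A @ G --> L -> mx_entry_cvg G A L.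
Proof.
move=> FG AL i j P nP; apply: (AL [set M | P (M i j)]).
(* Matrix neighbourhoods contain boxes of entry neighbourhoods; this box constrains only the entry
   [(i, j)]. *)
exists (fun i' j' => if (i' == i) && (j' == j) then P else setT).
  by move=> i' j'; case: ifP => [/andP[/eqP-> /eqP->]//|_]; exact: filterT.
by move=> M /(_ i j); rewrite !eqxx.
Qed.

Lemma cvg_finite_sum {R : realType} {T : Type} {G : set_system T} {I : finType}
    {f : I -> T -> R} {l : I -> R} : Filter G ->
  (forall i, f i @ G --> l i) -> (fun t => \sum_i f i t) @ G --> \sum_i l i.
Proof.
move=> FG fl; elim: (index_enum I) => [|i s IHs].
  by rewrite big_nil; under eq_fun do rewrite big_nil; exact: cvg_cst.
by rewrite big_cons; under eq_fun do rewrite big_cons; exact: cvgD.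
Qed.

Section EntrywiseLimits.
Context {R : realType} {T : Type} {G : set_system T} {FG : Filter G}.

Lemma mx_entry_cvg_cst {m n : nat} (A : 'M[R]_(m, n)) :
  mx_entry_cvg G (fun=> A) A.
Proof. by move=> i j; exact: cvg_cst. Qed.

Lemma mx_entry_cvg_tr {m n : nat} {A : T -> 'M[R]_(m, n)} {L : 'M[R]_(m, n)} :
  mx_entry_cvg G A L -> mx_entry_cvg G (fun t => (A t)^T) L^T.
Proof. by move=> AL i j; rewrite mxE; under eq_fun do rewrite mxE; exact: AL. Qed.

Lemma mx_entry_cvg_mulmx {m n p : nat} {A : T -> 'M[R]_(m, n)}
    {B : T -> 'M[R]_(n, p)} {L : 'M[R]_(m, n)} {M : 'M[R]_(n, p)} :
  mx_entry_cvg G A L -> mx_entry_cvg G B M ->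
  mx_entry_cvg G (fun t => A t *m B t) (L *m M).
Proof.
move=> AL BM i j; rewrite mxE; under eq_fun do rewrite mxE.
by apply: cvg_finite_sum => k; exact: cvgM.
Qed.

Lemma frobenius_cvg {m n : nat} {A B : T -> 'M[R]_(m, n)} {L M : 'M[R]_(m, n)} :
  mx_entry_cvg G A L -> mx_entry_cvg G B M ->
  (fun t => frobenius (A t) (B t)) @ G --> frobenius L M.
Proof.
move=> AL BM; apply: cvg_finite_sum => i; apply: cvg_finite_sum => j.
exact: cvgM.
Qed.

Lemma l1norm_cvg {m n : nat} {A : T -> 'M[R]_(m, n)} {L : 'M[R]_(m, n)} :
  mx_entry_cvg G A L -> (fun t => l1norm (A t)) @ G --> l1norm L.
Proof.
move=> AL; apply: cvg_finite_sum => i; apply: cvg_finite_sum => j.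
exact: cvg_norm.
Qed.

End EntrywiseLimits.

Lemma mx_entry_cvg_unique {R : realType} {T : Type} {G : set_system T}
    {m n : nat} {A : T -> 'M[R]_(m, n)} {L M : 'M[R]_(m, n)} :
  ProperFilter G -> mx_entry_cvg G A L -> mx_entry_cvg G A M -> L = M.
Proof.
by move=> PG AL AM; apply/matrixP => i j; exact: cvg_unique (AL i j) (AM i j).
Qed.

Lemma stiefel_cvg {R : realType} {T : Type} {G : set_system T} {m n : nat}
    {U : T -> 'M[R]_(m, n)} {L : 'M[R]_(m, n)} : ProperFilter G ->
  mx_entry_cvg G U L -> (forall t, stiefel (U t)) -> stiefel L.
Proof.
move=> PG UL StU; rewrite /stiefel /=.
(* The products [U^T U] tend to [L^T L] but are constantly the identity. *)
have := mx_entry_cvg_mulmx (mx_entry_cvg_tr UL) UL.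
under eq_fun do rewrite (StU _).
by move=> LL; exact: (mx_entry_cvg_unique PG (LL _) (mx_entry_cvg_cst _)).
Qed.

Lemma l1_subdiff_cvg {R : realType} {T : Type} {G : set_system T} {m n : nat}
    {V S : T -> 'M[R]_(m, n)} {W L : 'M[R]_(m, n)} : ProperFilter G ->
  mx_entry_cvg G V W -> mx_entry_cvg G S L ->
  (forall t, l1_subdiff (V t) (S t)) -> l1_subdiff W L.
Proof.
move=> PG VW SL SV; apply/l1_subdiffP => i j.
have {}SV t := (l1_subdiffP _ _).1 (SV t) i j; split.
  apply/andP; split.
    by apply: cvgr_to_ge (SL i j) _; apply: nearW => t; case/andP: (SV t).1.
  by apply: cvgr_to_le (SL i j) _; apply: nearW => t; case/andP: (SV t).1.
(* The products of entries of [S] and [V] are the absolute values of the entries of [V], so the two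
   limits agree. *)
apply: (cvg_unique _ (cvgM (SL i j) (VW i j))) => //.
rewrite (_ : _ \* _ = fun t => `|V t i j|); first exact: cvg_norm.
by apply/funext => t; exact: (SV t).2.
Qed.

Lemma ultra_bounded_mx_entry_cvg {R : realType} {T : Type} {G : set_system T}
    {m n : nat} {S : T -> 'M[R]_(m, n)} : UltraFilter G ->
  (forall t i j, -1 <= S t i j <= 1) -> exists L, mx_entry_cvg G S L.
Proof.
move=> UG S1.
have cvgS i j : exists l : R, (fun t => S t i j) @ G --> l.
  have S1G : ((fun t => S t i j) @ G) `[-1, 1]%classic.
    by apply: (@filterE _ G) => t; rewrite /= in_itv; exact: S1.
  have [l [_ /cluster_image_ultra[G' [UG' GG' Sl]]]] :=
    @segment_compact R (-1) 1 _ _ S1G.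
  (* Compactness gives a cluster point, hence convergence along a finer [G']; maximality of [G]
     forces [G' = G]. *)
  by exists l; rewrite -(@max_filter _ G _ G' _ GG').
exists (\matrix_(i, j) xget 0 [set l : R | (fun t => S t i j) @ G --> l]).
by move=> i j; rewrite mxE; exact: (xgetPex 0 (cvgS i j)).
Qed.

Section Scheme.
Context {R : realType} {d n K : nat} {X : 'M[R]_(d, n)}
  {U : nat -> 'M[R]_(d, K)} {S : nat -> 'M[R]_(n, K)}
  (U_scheme : condGradU X U S).

Lemma condGradU_bounded k i j : -1 <= S k i j <= 1.
Proof. by have [/l1_subdiffP /(_ i j)[]] := U_scheme k. Qed.

Lemma condGradU_max (k : nat) (Z : 'M[R]_(d, K)) :
  stiefel Z -> frobenius (X *m S k) Z <= objective X (U k.+1).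
Proof.
move=> StZ; have [_ PD] := U_scheme k.
apply: (le_trans (is_PD_max _ PD StZ)); rewrite frobenius_mulmxl.
(* [S k] need not be a subgradient at the new iterate [U k.+1]; the bound on its entries
   suffices. *)
by apply: frobenius_le_l1norm; exact: condGradU_bounded.
Qed.

Lemma condGradU_monotone (k : nat) :
  stiefel (U k) -> objective X (U k) <= objective X (U k.+1).
Proof.
move=> /(condGradU_max k); apply: le_trans.
by rewrite frobenius_mulmxl (frobenius_subdiff (U_scheme k).1).
Qed.

End Scheme.

Theorem proposition3p3 (R : realType) (d n K : nat) (X : 'M[R]_(d, n))
    (U : nat -> 'M[R]_(d, K)) (S : nat -> 'M[R]_(n, K))
    (K_ge1 : (1 <= K)%N) (K_le_d : (K <= d)%N)
    (U_stiefel : forall k : nat, stiefel (U k))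
    (U_scheme : condGradU X U S) :
  (forall k : nat, objective X (U k.+1) >= objective X (U k)) /\
  (forall L : 'M[R]_(d, K), cluster (U @ \oo) L -> foc_point X L).
Proof.
have mono k : objective X (U k) <= objective X (U k.+1).
  exact: condGradU_monotone.
split=> // L /cluster_image_ultra[G [UG leG /cvg_mx_entry UL]].
have [S' SS'] := ultra_bounded_mx_entry_cvg UG (condGradU_bounded U_scheme).
have XUL : mx_entry_cvg G (fun k => X^T *m U k) (X^T *m L).
  exact: mx_entry_cvg_mulmx (mx_entry_cvg_cst _) UL.
have dS' : l1_subdiff (X^T *m L) S'.
  by apply: (l1_subdiff_cvg _ XUL SS') => k; have [] := U_scheme k.
(* Along [G] only [U k] is known to tend to [L], not [U k.+1]. This bound at every index absorbs the
   shift in [condGradU_max]; it holds because the objective increases and [G] contains all tails. *)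
have leL k : objective X (U k) <= objective X L.
  apply: cvgr_to_ge (l1norm_cvg XUL) _; apply: leG.
  by exists k => // j /= kj; exact: (homo_leq (@lexx _ R) le_trans mono).
split; first exact: stiefel_cvg UL U_stiefel.
exists (X *m S'); first by exists S'.
move=> Z StZ; rewrite frobeniusBr subr_ge0 frobenius_mulmxl.
(* The right side becomes the objective at [L], a constant, so the limit is taken on the left
   only. *)
rewrite [leRHS]frobenius_mulmxl (frobenius_subdiff dS').
apply: cvgr_to_le (frobenius_cvg SS' (mx_entry_cvg_cst _)) _.
apply: nearW => k; rewrite -frobenius_mulmxl.
exact: le_trans (condGradU_max U_scheme k Z StZ) (leL k.+1).
Qed.
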